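(* The hitting-time-to-driver map $\tau\mapsto\xi$ is well defined and continuous at the zero driver $\mathbf{0}(t)\equiv0$, in the following precise sense. (i) Let $y_0>0$. If $\xi\in C([0,T])$ has hitting times $\tau(x;\xi)=x^2/4$ for all $x\in[-y_0,y_0]$, then $\xi(t)=0$ for all $0\le t\le y_0^2/4$. (ii) Let $a<0$. If $\tau_n:[a_n,b_n]\to\mathbb{R}$ are the hitting time functions for drivers $\xi_n\in S_0([0,T_n])$ with $a_n\to a$, $b_n\to-a$, and $\tau_n$ converges uniformly on compact subsets of $(a,-a)$ to the hitting time function $\tau_{\mathbf{0}}(x)=x^2/4$ of the zero driver, then $\xi_n$ converges uniformly to $\mathbf{0}$ on any $[0,T']\subset[0,T)$, where $T=\tau_{\mathbf{0}}(a)=a^2/4$.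
   Context: A driver is a continuous function $\xi:[0,T]\to\mathbb{R}$; $C([0,T])$ is the set of all of them. The upwards Loewner flow of $\xi$ in the upper half plane $\mathbb{H}$ is the solution of $\partial_t h_t(z)=\frac{-2}{h_t(z)-\xi(t)}$, $h_0(z)=z$; for $z\in\mathbb{H}$ it exists on all of $[0,T]$. Hitting times: for $x\in\mathbb{R}\setminus\{\xi(0)\}$, let $x(t)=h_t(x;\xi)$ be the real solution of the same ODE started at $x$, and let $\tau(x;\xi):=\inf\{t\ge 0: \liminf_{s\nearrow t}|x(s)-\xi(s)|=0\}$ (with $t\in[0,T]$ and $\inf\emptyset=+\infty$); also $\tau(\xi(0);\xi)=0$. Simple-curve drivers: $S([0,T])$ is the set of continuous $\xi:[0,T]\to\mathbb{R}$ that generate a simple curve, i.e. there is an injective continuous $\gamma:[0,T]\to\mathbb{H}\cup\{\xi(T)\}$ with $\gamma(0)=\xi(T)$ and $\gamma((0,T])\subset\mathbb{H}$ such that $h_T$ maps $\mathbb{H}$ conformally onto $\mathbb{H}\setminus\gamma((0,T])$. $S_0([0,T])$ is the set of $\xi\in S([0,T])$ with $\xi(0)=0$. In (ii), $\tau_n=\tau(\cdot;\xi_n)$ and $[a_n,b_n]$ is the maximal interval on which $\tau(\cdot;\xi_n)$ is finite, so that $\tau_n(a_n)=\tau_n(b_n)=T_n$. *)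

(* Defs.v *)
From HB Require Import structures.
From mathcomp Require Import all_boot all_order all_algebra.
From mathcomp Require Import complex.
From mathcomp Require Import all_classical all_reals all_analysis.

Set Implicit Arguments.
Unset Strict Implicit.
Unset Printing Implicit Defensive.

Import Order.TTheory GRing.Theory Num.Theory numFieldNormedType.Exports.

Local Open Scope classical_set_scope.
Local Open Scope ring_scope.

(* R[i] seen as a numFieldType, so that it carries the usual topology and the
   usual structure of normed module over itself: [derivable] is then complex
   differentiability. *)
Definition cplx (R : realType) : numFieldType := R[i]%C.

Definition upper_half_plane (R : realType) : set (cplx R) :=
  [set z | 0 < complex.Im z].

Definition driver (R : realType) (T : R) (xi : R -> R) : Prop :=
  {within `[0, T], continuous xi}.

(* du/dt = -2 / (u(t) - xi(t)) for t in I, with u(t) in K; iota is the embedding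
   of the reals in K, namely id for K = R and real_complex R for K = R[i].
   The derivative is relative to I, hence one-sided at the endpoints of an
   interval I. The condition u(t) != xi(t) is explicit because 0^-1 = 0 in K. *)
Definition loewner_ode (R : realType) (K : numFieldType) (iota : R -> K)
    (I : set R) (xi : R -> R) (u : R -> K) : Prop :=
  forall t, I t -> u t != iota (xi t) /\
    (u s - u t) / iota (s - t) @[s --> within I t^']
      --> - 2 / (u t - iota (xi t)).

Definition upward_flow (R : realType) (T : R) (xi : R -> R)
    (h : R -> cplx R -> cplx R) : Prop :=
  forall z, upper_half_plane z ->
    [/\ h 0 z = z,
        forall t, `[0, T]%classic t -> upper_half_plane (h t z) &
        loewner_ode (real_complex R : R -> cplx R) `[0, T] xi (h ^~ z)].

(* The solution started at the real point x is unique on each [0, t[ where it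
   exists, hence [exists u] below refers to the restriction of h_s(x; xi) to
   [0, t[. The liminf as s tends to 0 from the left is over no time at all, which
   is why only t > 0 occurs. The infimum of the empty set is +oo. *)
Definition hitting_time (R : realType) (T : R) (xi : R -> R) (x : R) : \bar R :=
  if x == xi 0 then 0%E else
  ereal_inf [set t%:E | t in [set t : R | 0 < t <= T /\
    exists u : R -> R,
      [/\ u 0 = x,
          loewner_ode (id : R -> R) `[0, t[ xi u &
          limf_einf (fun s => `|u s - xi s|%:E) t^'- = 0%E]]].

Definition conformal_onto (R : realType) (f : cplx R -> cplx R)
    (A B : set (cplx R)) : Prop :=
  [/\ forall z, A z -> derivable f z 1, set_inj A f & f @` A = B].

Definition simple_curve_driver (R : realType) (T : R) (xi : R -> R) : Prop :=
  driver T xi /\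
  exists (h : R -> cplx R -> cplx R) (gamma : R -> cplx R),
    upward_flow T xi h /\
    [/\ {within `[0, T], continuous gamma},
        set_inj `[0, T] gamma,
        gamma 0 = real_complex R (xi T),
        gamma @` `]0, T] `<=` @upper_half_plane R &
        conformal_onto (h T) (@upper_half_plane R)
          (@upper_half_plane R `\` gamma @` `]0, T])].

Definition simple_curve_driver0 (R : realType) (T : R) (xi : R -> R) : Prop :=
  simple_curve_driver T xi /\ xi 0 = 0.

Definition maximal_finite_interval (R : realType) (tau : R -> \bar R)
    (a b : R) : Prop :=
  [/\ a <= b,
      forall x, `[a, b]%classic x -> tau x \is a fin_num &
      forall I : set R, is_interval I -> `[a, b] `<=` I ->
        (forall x, I x -> tau x \is a fin_num) -> I `<=` `[a, b]].

(* Main.v *)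
Require Import Defs.
From HB Require Import structures.
From mathcomp Require Import all_boot all_order all_algebra.
From mathcomp Require Import complex.
From mathcomp Require Import all_classical all_reals all_analysis.
From mathcomp Require Import ring lra.
Import Order.TTheory GRing.Theory Num.Theory numFieldNormedType.Exports.
Local Open Scope classical_set_scope.
Local Open Scope ring_scope.
Set Implicit Arguments.
Unset Strict Implicit.

(** Let u and v solve the flow started at y and - y, with the driver at 0
    initially. As long as both exist, v < xi < u; put a := u - xi, b := xi - v,
    d := u - v = a + b and m := (u + v) / 2. Then d' = - 2 / a - 2 / b and
    1 / a + 1 / b >= 4 / (a + b), so that (d ^ 2)' <= - 16, with equality
    exactly when a = b. A pair that survives up to time S therefore satisfies
    y ^ 2 >= 4 S, and the points +-y of the zero driver, which are hit at time
    y ^ 2 / 4, are the extremal pairs: hitting times x ^ 2 / 4 force a = b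
    throughout, hence m' = (a - b) / (a b) = 0 and xi = m = 0.

    The quantitative form of this rigidity argument gives (i) and (ii) together.
    If the points +-y survive up to S with 4 y ^ 2 - 16 S small, then the
    integral of (a - b) ^ 2 / (a b) is small, and so is the displacement of m up
    to any t < S, since m' = (a - b) / (a b) and the integral of 1 / (a b) is
    controlled as long as d stays away from 0. Integrals do not appear below:
    the Cauchy-Schwarz step becomes the monotonicity of
    al * (d ^ 2 + 16 s) + be * d +- m, whose slope is - 1 / (a b) times a
    quadratic in a - b that is nonnegative if 32 al be d >= 1
    ([slope_le0], [straddling_potential]).

    To bound xi t, the pair with y ^ 2 = 4 (t + r ^ 2) is used, for a small r
    that does not depend on t. At time t its gap is of order r: small enough
    that m t is close to xi t, which lies between v t and u t, and large enough
    for m t to be controlled by the error on the hitting times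
    ([straddling_driver_bound], [near_zero_hitting_times]). In (i) the equality
    xi 0 = 0 has to be derived first; it follows from the fact that, on one side
    of the driver, points closer to it are hit earlier ([hitting_time_le]). *)

(** * Solutions of the real Loewner equation *)

Definition real_solution {R : realType} (S : R) (xi u : R -> R) : Prop :=
  loewner_ode (id : R -> R) `[0, S[ xi u.

Lemma loewner_ode_continuous (R : realType) (I : set R) (xi u : R -> R) :
  loewner_ode (id : R -> R) I xi u -> {within I, continuous u}.
Proof.
move=> ode; apply/subspace_continuousP => t It.
have [_ du] := ode t It.
have cv : u t + (u s - u t) / (s - t) * (s - t) @[s --> within I t^'] --> u t.
  have st : s - t @[s --> within I t^'] --> 0.
    rewrite -(subrr t); apply: cvgB; last exact: cvg_cst.
    by apply: cvg_within_filter; apply: cvg_within.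
  rewrite -[X in _ --> X]addr0 -(mulr0 (- 2 / (u t - id (xi t)))).
  apply: cvgD; first exact: cvg_cst.
  exact: cvgM du st.
apply/cvgrPdist_lt => e e0.
have {}cv : \forall s \near t, s != t -> I s ->
    `|u t - (u t + (u s - u t) / (s - t) * (s - t))| < e.
  by move/cvgrPdist_lt : cv => /(_ e e0).
suff : \forall s \near t, I s -> `|u t - u s| < e by [].
apply: filterS cv => s cv Is.
have [->|st] := eqVneq s t; first by rewrite subrr normr0.
by have := cv st Is; rewrite divfK ?subr_eq0// subrKC.
Qed.

Lemma loewner_ode_is_derive (R : realType) (I : set R) (xi u : R -> R) (t : R) :
  loewner_ode (id : R -> R) I xi u -> nbhs t I ->
  is_derive t 1 u (- 2 / (u t - xi t)).
Proof.
move=> ode tI; have [_ du] := ode t (nbhs_singleton tI).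
suff dq : h^-1 *: (u (h *: 1 + t) - u t) @[h --> 0^'] -->
    (- 2 / (u t - xi t)).
  by apply: DeriveDef; [apply/cvg_ex; eexists; exact: dq|exact: cvg_lim dq].
apply/cvgrPdist_lt => e e0.
have {}du : \forall s \near t, s != t -> I s ->
    `|- 2 / (u t - xi t) - (u s - u t) / (s - t)| < e.
  by move/cvgrPdist_lt : du => /(_ e e0).
suff : \forall h \near (0 : R), h != 0 ->
    `|- 2 / (u t - xi t) - h^-1 *: (u (h *: 1 + t) - u t)| < e by [].
have : \forall s \near t, s != t ->
    `|- 2 / (u t - xi t) - (u s - u t) / (s - t)| < e.
  by apply: filterS2 du tI => s du Is /du; apply.
rewrite (near_shift 0) subr0; apply: filterS => h /= + h0.
rewrite -subr_eq0 addrK => /(_ h0).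
rewrite [h *: 1]mulr1 [_ *: _]mulrC.
by [].
Qed.

Lemma nonzero_keeps_sign (R : realType) (S : R) (f : R -> R) :
  {within `[0, S[, continuous f} -> (forall t, 0 <= t < S -> f t != 0) ->
  0 < f 0 -> forall t, 0 <= t < S -> 0 < f t.
Proof.
move=> cf f_neq0 f0 t /andP[t0 tS]; rewrite ltNge; apply/negP => ft.
have ct : {within `[0, t], continuous f}.
  apply: continuous_subspaceW cf => s /=; rewrite !in_itv/= => /andP[-> st].
  exact: le_lt_trans tS.
have [|s] := IVT t0 ct (v := 0).
  by rewrite ge_min ft orbT le_max (ltW f0).
rewrite in_itv/= => /andP[s0 st] fs0.
by have := f_neq0 s; rewrite fs0 eqxx s0 (le_lt_trans st tS) => /(_ isT).
Qed.

(** * Pairs of solutions on both sides of the driver *)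

(** A combination of the squared gap, the gap, the midpoint and the time; every
    monotone quantity of the proof has this form. *)
Definition potential {R : realType} (al be ka ga : R) (u v : R -> R) (s : R) :=
  al * (u s - v s) ^+ 2 + be * (u s - v s) + ka * ((u s + v s) / 2) + ga * s.

Lemma potential_continuous (R : realType) (A : set R) (al be ka ga : R)
    (u v : R -> R) :
  {within A, continuous u} -> {within A, continuous v} ->
  {within A, continuous (potential al be ka ga u v)}.
Proof.
move=> cu cv.
have cid : {within A, continuous (id : R -> R)}.
  by apply: continuous_subspaceT => r.
have cd : {within A, continuous (fun s => u s - v s)}.
  by move=> r; exact: cvgB (cu r) (cv r).
have cd2 : {within A, continuous (fun s => (u s - v s) ^+ 2)}.
  by move=> r; exact: continuous_comp (cd r) (@exprn_continuous _ 2 _).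
have cm : {within A, continuous (fun s => (u s + v s) / 2)}.
  by move=> r; apply: cvgM; [exact: cvgD (cu r) (cv r)|exact: cvg_cst].
move=> r; apply: cvgD; first apply: cvgD; first apply: cvgD.
- by apply: cvgM; [exact: cvg_cst|exact: cd2].
- by apply: cvgM; [exact: cvg_cst|exact: cd].
- by apply: cvgM; [exact: cvg_cst|exact: cm].
- by apply: cvgM; [exact: cvg_cst|exact: cid].
Qed.

Lemma potential_is_derive (R : realType) (al be ka ga r du dv : R)
    (u v : R -> R) :
  is_derive r 1 u du -> is_derive r 1 v dv ->
  is_derive r 1 (potential al be ka ga u v)
    (2 * al * (u r - v r) * (du - dv) + be * (du - dv)
     + ka * ((du + dv) / 2) + ga).
Proof.
move=> hu hv.
have -> : potential al be ka ga u v = al \*: (u - v) ^+ 2 + be \*: (u - v)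
    + (ka / 2) \*: (u + v) + ga \*: (id : R -> R).
  apply/funext => x; rewrite /potential !fctE /= /GRing.scale /=; ring.
have hd := is_deriveB hu hv.
have hm := is_deriveZ (ka / 2) (is_deriveD hu hv).
have hs := is_deriveZ ga (is_derive_id r (1 : R)).
have h := is_deriveD (is_deriveD (is_deriveD (is_deriveZ al (is_deriveX 2 hd))
  (is_deriveZ be hd)) hm) hs.
apply: (is_derive_eq h).
rewrite !fctE /= /GRing.scale /= mulr1; ring.
Qed.

Lemma potential_nincr (R : realType) (S al be ka ga s t : R) (xi u v : R -> R) :
  real_solution S xi u -> real_solution S xi v -> 0 <= s <= t -> t < S ->
  (forall r, 0 < r < t -> let a := u r - xi r in let b := xi r - v r in
     al * (2 * (a + b) * (- 2 / a - - 2 / - b)) + be * (- 2 / a - - 2 / - b)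
     + ka * ((- 2 / a + - 2 / - b) / 2) + ga <= 0) ->
  potential al be ka ga u v t <= potential al be ka ga u v s.
Proof.
move=> su sv /andP[s0 st] tS slope.
have sub : `[0, t] `<=` `[0, S[.
  by move=> r /=; rewrite !in_itv/= => /andP[-> rt]; exact: le_lt_trans tS.
have cF : {within `[0, t], continuous (potential al be ka ga u v)}.
  apply: (continuous_subspaceW sub); apply: potential_continuous;
  [exact: loewner_ode_continuous su|exact: loewner_ode_continuous sv].
have dF r : r \in `]0, t[ ->
    exists2 d, d <= 0 & is_derive r 1 (potential al be ka ga u v) d.
  rewrite in_itv/= => /andP[r0 rt].
  have nr : nbhs r `[0, S[%classic.
    have : nbhs r `]0, S[%classic.
      by apply: near_in_itvoo; rewrite in_itv/= r0 (lt_trans rt).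
    by apply: filterS => x /=; rewrite !in_itv/= => /andP[/ltW -> ->].
  have := potential_is_derive al be ka ga (loewner_ode_is_derive su nr)
    (loewner_ode_is_derive sv nr).
  move=> h; eexists; last exact: h.
  have := slope r; rewrite r0 rt => /(_ isT) /=; apply: le_trans.
  rewrite le_eqVlt; apply/orP; left; apply/eqP.
  have -> : u r - xi r + (xi r - v r) = u r - v r by ring.
  by rewrite opprB; ring.
apply: (ler0_derive1_le_cc _ _ cF);
  rewrite ?in_itv/= ?s0 ?lexx ?(le_trans s0)//.
- by move=> r /dF[d _ h]; case: h.
- by move=> r /dF[d d0 [_ h]]; rewrite derive1E h.
Qed.

Definition straddling {R : realType} (S : R) (xi u v : R -> R) : Prop :=
  [/\ {within `[0, S[, continuous xi}, real_solution S xi u,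
      real_solution S xi v & v 0 < xi 0 < u 0].

(** A solution never meets the driver, so the initial order persists. *)
Lemma straddling_lt (R : realType) (S t : R) (xi u v : R -> R) :
  straddling S xi u v -> 0 <= t < S -> v t < xi t < u t.
Proof.
move=> [cx su sv /andP[vx0 xu0]] tS.
have cu := loewner_ode_continuous su; have cv := loewner_ode_continuous sv.
rewrite -[v t < _]subr_gt0 -[xi t < _]subr_gt0; apply/andP; split.
- apply: (nonzero_keeps_sign (f := fun s => xi s - v s)) tS.
  + by move=> r; exact: cvgB (cx r) (cv r).
  + by move=> s sS; have [+ _] := sv s sS; rewrite subr_eq0 eq_sym.
  + by rewrite subr_gt0.
- apply: (nonzero_keeps_sign (f := fun s => u s - xi s)) tS.
  + by move=> r; exact: cvgB (cu r) (cx r).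
  + by move=> s sS; have [+ _] := su s sS; rewrite subr_eq0.
  + by rewrite subr_gt0.
Qed.

(** The slope is - 1 / (a b) times 4 al z ^ 2 - ka z + 2 be (a + b) with
    z := a - b; this quadratic in z is nonnegative because its discriminant
    ka ^ 2 - 32 al be (a + b) is nonpositive. *)
Lemma slope_le0 (R : realFieldType) (al be ka c a b : R) :
  0 < a -> 0 < b -> c <= a + b -> 0 < al -> 0 <= be ->
  ka ^+ 2 <= 32 * al * be * c ->
  al * (2 * (a + b) * (- 2 / a - - 2 / - b)) + be * (- 2 / a - - 2 / - b)
    + ka * ((- 2 / a + - 2 / - b) / 2) + 16 * al <= 0.
Proof.
move=> a0 b0 cab al0 be0 kac.
rewrite [X in X <= _](_ : _ = - ((8 * al * (a - b) - ka) ^+ 2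
    + (32 * al * be * (a + b) - ka ^+ 2)) / (16 * al * a * b)); last first.
  by field; rewrite !gt_eqF.
rewrite mulNr oppr_le0 divr_ge0//; last by rewrite !mulr_ge0// ltW.
rewrite addr_ge0 ?sqr_ge0// subr_ge0 (le_trans kac)// ler_wpM2l// !mulr_ge0//.
exact: ltW.
Qed.

(** For ka = 1 and ka = -1 the decrease of the potential bounds the displacement
    of the midpoint in both directions; ka = be = 0 gives the decrease of
    d ^ 2 + 16 s. *)
Lemma straddling_potential (R : realType) (S al be ka c s t : R)
    (xi u v : R -> R) :
  straddling S xi u v -> 0 <= s <= t -> t < S -> 0 < al -> 0 <= be ->
  ka ^+ 2 <= 32 * al * be * c -> (forall r, 0 <= r <= t -> c <= u r - v r) ->
  potential al be ka (16 * al) u v t <= potential al be ka (16 * al) u v s.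
Proof.
move=> suv st tS al0 be0 kac cle; have [_ su sv _] := suv.
apply: (potential_nincr su sv st tS) => r /andP[r0 rt] /=.
have /andP[vx xu] : v r < xi r < u r.
  by apply: (straddling_lt suv); rewrite ltW//= (lt_trans rt).
have [a0 b0] : 0 < u r - xi r /\ 0 < xi r - v r by rewrite !subr_gt0.
apply: (slope_le0 a0 b0 _ al0 be0 kac).
have -> : u r - xi r + (xi r - v r) = u r - v r by ring.
by apply: cle; rewrite !ltW.
Qed.

Lemma straddling_gap_nincr (R : realType) (S s t : R) (xi u v : R -> R) :
  straddling S xi u v -> 0 <= s <= t -> t < S ->
  (u t - v t) ^+ 2 + 16 * t <= (u s - v s) ^+ 2 + 16 * s.
Proof.
move=> suv st tS.
have := straddling_potential (al := 1) (be := 0) (ka := 0) (c := 0) suv st tS.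
rewrite /potential ltr01 lexx expr0n !mulr0 lexx !mul0r !addr0 !mul1r mulr1.
apply => // r /andP[r0 rt]; rewrite subr_ge0.
have /andP[vx xu] : v r < xi r < u r.
  by apply: (straddling_lt suv); rewrite r0 (le_lt_trans rt).
exact/ltW/(lt_trans vx).
Qed.

(** The quantity d ^ 2 + 16 s decreases on [t, S[, where it is at least 16 s,
    so its value at t is at least 16 S. *)
Lemma straddling_gap_ge (R : realType) (S t : R) (xi u v : R -> R) :
  straddling S xi u v -> 0 <= t < S -> 16 * (S - t) <= (u t - v t) ^+ 2.
Proof.
move=> suv /andP[t0 tS]; rewrite leNgt; apply/negP => lt.
(* midpoint of t + d(t) ^ 2 / 16 and S, where d ^ 2 would be negative *)
pose s := ((u t - v t) ^+ 2 / 16 + t + S) / 2.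
have d0 := sqr_ge0 (u t - v t).
have ts : 0 <= t <= s by rewrite t0 /s; lra.
have sS : s < S by rewrite /s; lra.
have sE : 2 * s = (u t - v t) ^+ 2 / 16 + t + S by rewrite /s; field.
have := straddling_gap_nincr suv ts sS; have := sqr_ge0 (u s - v s).
by clearbody s; lra.
Qed.

(** The first two terms bound the displacement of the midpoint, which starts at
    0, and the last one bounds half of the gap at time t, hence the distance of
    the driver to the midpoint. *)
Lemma straddling_driver_bound (R : realType) (S al be c r y t : R)
    (xi u v : R -> R) :
  straddling S xi u v -> u 0 = y -> v 0 = - y -> 0 <= t < S ->
  0 < al -> 0 <= be -> 0 <= c -> 1 <= 32 * al * be * c ->
  c ^+ 2 <= 16 * (S - t) -> 0 <= r -> y ^+ 2 - 4 * t <= r ^+ 2 ->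
  `|xi t| <= al * (4 * y ^+ 2 - 16 * S) + 2 * be * y + r.
Proof.
move=> suv u0 v0 /andP[t0 tS] al0 be0 c0 abc cS r0 yr.
have sx s : 0 <= s < S -> v s < xi s < u s by exact: straddling_lt.
have cle s : 0 <= s <= t -> c <= u s - v s.
  move=> /andP[s0 st]; have sS := le_lt_trans st tS.
  have := sx s; rewrite s0 sS => /(_ isT)/andP[vx xu].
  rewrite -ler_sqr ?nnegrE// ?subr_ge0 ?(ltW (lt_trans vx xu))//.
  have sS' : 0 <= s < S by rewrite s0.
  by apply: (le_trans cS); apply: le_trans (straddling_gap_ge suv sS'); lra.
have t00 : 0 <= (0 : R) <= t by rewrite lexx t0.
have gt : 16 * (S - t) <= (u t - v t) ^+ 2.
  by apply: (straddling_gap_ge suv); rewrite t0.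
have gt0 := straddling_gap_nincr suv t00 tS.
have P ka : ka ^+ 2 = 1 -> al * (16 * S) + ka * ((u t + v t) / 2)
    <= al * (4 * y ^+ 2) + 2 * be * y.
  move=> ka1.
  have := straddling_potential (ka := ka) (c := c) suv t00 tS al0 be0.
  rewrite ka1 => /(_ abc cle); rewrite /potential u0 v0.
  have := ler_wpM2l (ltW al0) gt.
  have := mulr_ge0 be0 (le_trans c0 (cle t _)).
  rewrite t0 lexx => /(_ isT).
  nra.
have := P 1; rewrite expr1n => /(_ erefl).
have := P (-1); rewrite sqrrN expr1n => /(_ erefl).
have /andP[vx xu] : v t < xi t < u t by apply: sx; rewrite t0.
have d2r : u t - v t <= 2 * r.
  rewrite -ler_sqr ?nnegrE ?subr_ge0 ?(ltW (lt_trans vx xu)) ?mulr_ge0//.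
  rewrite exprMn; move: gt0; rewrite u0 v0; lra.
rewrite ler_norml => ? ?; apply/andP; split; lra.
Qed.

(** * Hitting times *)

Lemma loewner_ode_subset (R : realType) (I J : set R) (xi u : R -> R) :
  J `<=` I -> loewner_ode (id : R -> R) I xi u ->
  loewner_ode (id : R -> R) J xi u.
Proof.
move=> JI ode t Jt; have [ut du] := ode t (JI t Jt); split => //.
by apply: cvg_trans du; apply: cvg_app; apply: within_subset JI.
Qed.

(** A finite hitting time is an infimum over a nonempty set of times, each of
    which comes with a solution living at least until the infimum. *)
Lemma hitting_time_solution (R : realType) (T tau x : R) (xi : R -> R) :
  hitting_time T xi x = tau%:E -> x != xi 0 ->
  tau <= T /\ exists2 u, u 0 = x & real_solution tau xi u.
Proof.
rewrite /hitting_time => + /negPf x0; rewrite x0.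
set A := [set t%:E | t in _] => infA.
have /set0P[_ [t [/andP[t0 tT] [u [u0 su lim0]]] _]] : A != set0.
  by apply: contra_eqN infA => /eqP ->; rewrite ereal_inf0.
have tau_t : tau <= t.
  rewrite -lee_fin -infA; apply: ereal_inf_lbound; exists t => //.
  by split; [rewrite t0|exists u].
split; first exact: le_trans tT.
exists u => //; apply: loewner_ode_subset su => s /=; rewrite !in_itv/=.
by move=> /andP[-> /lt_le_trans]; apply.
Qed.

Lemma limf_einf_at_left_ge (R : realType) (t m : R) (f : R -> R) :
  0 < t -> (forall s, 0 <= s < t -> m <= f s) ->
  (m%:E <= limf_einf (fun s => (f s)%:E) t^'-)%E.
Proof.
move=> t0 mf; rewrite limf_einfE.
apply: (@le_trans _ _ (ereal_inf ((fun s => (f s)%:E) @` `[0, t[))).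
  by apply: le_ereal_inf_tmp => _ [s st <-]; rewrite lee_fin mf.
apply: ereal_sup_ubound; exists `[0, t[%classic => //.
have : \forall s \near t^'-, 0 < s by exact: nbhs_left_gt.
apply: filterS2 (nbhs_left_lt t) => s st s0.
by rewrite /= in_itv/= (ltW s0).
Qed.

Lemma limf_einf_at_left_eq0 (R : realType) (t : R) (f : R -> R) :
  (forall s, 0 <= f s) -> f s @[s --> t^'-] --> 0 ->
  limf_einf (fun s => (f s)%:E) t^'- = 0%E.
Proof.
move=> f0 cf; rewrite limf_einfE; apply/eqP; rewrite eq_le; apply/andP; split.
  apply: ge_ereal_sup => _ [V tV <-]; apply/lee_addgt0Pr => e e0.
  have fe : \forall s \near t^'-, f s < e.
    by apply: (cvgr_lt _ cf).
  have [s [Vs fs]] := filter_ex (filterI tV fe).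
  rewrite add0e; apply: (@le_trans _ _ (f s)%:E); last by rewrite lee_fin ltW.
  by apply: ereal_inf_lbound; exists s.
apply: (@le_trans _ _ (ereal_inf ((fun s => (f s)%:E) @` setT))).
  by apply: le_ereal_inf_tmp => _ [s st <-]; rewrite lee_fin.
by apply: ereal_sup_ubound; exists setT => //; exact: filterT.
Qed.

Lemma nonzero_bounded_away (R : realType) (t : R) (f : R -> R) :
  0 <= t -> {within `[0, t], continuous f} ->
  (forall s, 0 <= s <= t -> f s != 0) ->
  exists2 m, 0 < m & forall s, 0 <= s <= t -> m <= `|f s|.
Proof.
move=> t0 cf f_neq0.
have cn : {within `[0, t], continuous (fun s => `|f s|)}.
  by move=> s; exact: cvg_norm (cf s).
have [c ct cmin] := EVT_min t0 cn.
exists `|f c|; last by move=> s st; apply: cmin; rewrite in_itv.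
by rewrite normr_gt0; apply: f_neq0; move: ct; rewrite in_itv.
Qed.

(** Two solutions on the same side of the driver repel each other:
    ((v - u) ^ 2)' = 4 (v - u) ^ 2 / ((xi - u) (xi - v)). Hence the solution u
    from x stays behind the solution v from y, and it cannot approach the driver
    before v does. *)
Lemma hitting_time_le (R : realType) (T tau x y : R) (xi : R -> R) :
  driver T xi -> hitting_time T xi y = tau%:E -> 0 < (y - x) * (xi 0 - y) ->
  (tau%:E <= hitting_time T xi x)%E.
Proof.
move=> cxi tauy yx.
have yxi : y != xi 0.
  by apply: contraTneq yx => ->; rewrite subrr mulr0 ltxx.
have xxi : x != xi 0.
  apply/eqP => xE; move: yx; rewrite -xE -[x - y]opprB mulrN ltNge.
  by rewrite oppr_le0 -expr2 sqr_ge0.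
have [tauT [v v0 sv]] := hitting_time_solution tauy yxi.
rewrite /hitting_time (negPf xxi).
apply: le_ereal_inf_tmp => _ [t [/andP[t0 tT] [u [u0 su lim0]]] <-].
rewrite lee_fin leNgt; apply/negP => ttau.
have sub : `[0, t[ `<=` `[0, tau[.
  move=> s /=; rewrite !in_itv/= => /andP[-> st]; exact: lt_trans ttau.
have svt : real_solution t xi v by apply: (loewner_ode_subset sub).
have cu := loewner_ode_continuous su; have cv := loewner_ode_continuous svt.
have cx : {within `[0, t[, continuous xi}.
  apply: continuous_subspaceW cxi => s /=; rewrite !in_itv/= => /andP[-> st].
  exact: ltW (lt_le_trans st tT).
have usne s : 0 <= s < t -> xi s - u s != 0.
  by move=> st; have [+ _] := su s st; rewrite subr_eq0 eq_sym.
have vsne s : 0 <= s < tau -> xi s - v s != 0.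
  by move=> st; have [+ _] := sv s st; rewrite subr_eq0 eq_sym.
have tau_t s : 0 <= s < t -> 0 <= s < tau.
  by case/andP=> -> /lt_trans; apply.
have same_side s : 0 <= s < t -> 0 < (xi s - u s) * (xi s - v s).
  apply: (nonzero_keeps_sign (f := fun s => (xi s - u s) * (xi s - v s))).
  - move=> r; exact: cvgM (cvgB (cx r) (cu r)) (cvgB (cx r) (cv r)).
  - by move=> r rt; rewrite mulf_neq0 ?usne ?vsne ?tau_t.
  - rewrite u0 v0; have := sqr_ge0 (xi 0 - y); nra.
have repel s : 0 <= s < t -> (v 0 - u 0) ^+ 2 <= (v s - u s) ^+ 2.
  move=> /andP[s0 st].
  have s00 : 0 <= (0 : R) <= s by rewrite lexx.
  have := potential_nincr (al := -1) (be := 0) (ka := 0) (ga := 0) svt su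
    s00 st.
  rewrite /potential => h.
  suff : -1 * (v s - u s) ^+ 2 + 0 * (v s - u s) + 0 * ((v s + u s) / 2)
      + 0 * s <= -1 * (v 0 - u 0) ^+ 2 + 0 * (v 0 - u 0)
      + 0 * ((v 0 + u 0) / 2) + 0 * 0 by lra.
  apply: h => r /andP[r0 rs] /=.
  have := same_side r; rewrite ltW//= (lt_trans rs st) => /(_ isT) AB.
  rewrite [X in X <= _](_ : _ = - (4 * (v r - u r) ^+ 2
      / ((xi r - u r) * (xi r - v r)))).
    by rewrite oppr_le0 divr_ge0 ?(ltW AB)// mulr_ge0// sqr_ge0.
  have rt : 0 <= r < t by rewrite ltW//= (lt_trans rs).
  have uN0 := usne r rt; have vN0 := vsne r (tau_t r rt).
  have vN0' : v r - xi r != 0 by rewrite -opprB oppr_eq0.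
  by field; rewrite uN0 vN0 ?vN0'.
have between s : 0 <= s < t -> 0 < (v s - u s) * (xi s - v s).
  apply: (nonzero_keeps_sign (f := fun s => (v s - u s) * (xi s - v s))).
  - move=> r; exact: cvgM (cvgB (cv r) (cu r)) (cvgB (cx r) (cv r)).
  - move=> r rt; rewrite mulf_neq0 ?vsne ?tau_t// -sqrf_eq0 gt_eqF//.
    apply: lt_le_trans (repel r rt); rewrite exprn_even_gt0//= u0 v0.
    by apply: contraTneq yx => ->; rewrite mul0r ltxx.
  - by rewrite u0 v0.
have [m m0 mle] : exists2 m, 0 < m &
    forall s, 0 <= s <= t -> m <= `|xi s - v s|.
  apply: nonzero_bounded_away (ltW t0) _ _; last first.
    by move=> s /andP[s0 st]; apply: vsne; rewrite s0 (le_lt_trans st).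
  have cvt : {within `[0, t], continuous v}.
    apply: continuous_subspaceW (loewner_ode_continuous sv) => s /=.
    by rewrite !in_itv/= => /andP[-> /le_lt_trans]; apply.
  have cxt : {within `[0, t], continuous xi}.
    apply: continuous_subspaceW cxi => s /=.
    by rewrite !in_itv/= => /andP[-> /le_trans]; apply.
  by move=> s; exact: cvgB (cxt s) (cvt s).
have : (m%:E <= limf_einf (fun s => `|u s - xi s|%:E) t^'-)%E.
  apply: limf_einf_at_left_ge => // s /[dup] st /andP[s0 /ltW st'].
  apply: (le_trans (mle s _)); first by rewrite s0.
  rewrite -ler_sqr ?nnegrE// !real_normK ?num_real//.
  have := between s st; have := sqr_ge0 (v s - u s); nra.
by rewrite lim0 lee_fin leNgt m0.
Qed.

(** * Hitting times close to those of the zero driver *)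

(** The constants: r makes half of the gap at time t, at most 2 r, contribute
    at most eta / 2; then be makes 2 be y at most eta / 4; al is the smallest
    value allowed by 32 al be c >= 1 with c := 2 r, a lower bound of the gap up
    to t; finally eps makes 16 al eps at most eta / 4. *)
Lemma near_zero_hitting_times (R : realType) (T' Tm eta : R) :
  0 <= T' -> T' < Tm -> 0 < eta ->
  exists2 eps, 0 < eps & forall (T : R) (xi : R -> R), driver T xi ->
    xi 0 = 0 ->
    (forall x, x ^+ 2 <= 4 * Tm ->
       exists2 tau, hitting_time T xi x = tau%:E &
         `|tau - x ^+ 2 / 4| <= eps) ->
    forall t, 0 <= t <= T' -> t <= T /\ `|xi t| <= eta.
Proof.
move=> T'0 T'm eta0.
pose r := Num.min (eta / 4) (Num.min 1 (Tm - T')).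
have r0 : 0 < r by rewrite !lt_min ltr01 subr_gt0 T'm divr_gt0.
have [reta [r1 rTm]] : r <= eta / 4 /\ r <= 1 /\ r <= Tm - T'.
  by rewrite /r !ge_min !lexx !orbT.
clearbody r.
have r2 : r ^+ 2 <= Tm - T'.
  by apply: le_trans rTm; rewrite expr2 ger_pMl.
have r20 : 0 < r ^+ 2 by rewrite exprn_gt0.
pose Y := Tm + 1.
have Y0 : 0 < Y by rewrite /Y; lra.
pose be := eta / (8 * Y).
have be0 : 0 < be by rewrite divr_gt0// mulr_gt0.
have beY : 8 * (be * Y) = eta by rewrite /be; field; rewrite gt_eqF.
pose al := (64 * be * r)^-1.
have al0 : 0 < al by rewrite invr_gt0 mulr_gt0// mulr_gt0.
have al1 : 64 * al * be * r = 1 by rewrite /al; field; rewrite !gt_eqF.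
pose eps := Num.min (r ^+ 2 / 2) (eta / (64 * al)).
have eps0 : 0 < eps.
  rewrite lt_min; apply/andP; split; apply: divr_gt0 => //.
  exact: mulr_gt0.
have epsr : eps <= r ^+ 2 / 2 by rewrite /eps ge_min lexx.
have epsal : 64 * (al * eps) <= eta.
  have : eps <= eta / (64 * al) by rewrite /eps ge_min lexx orbT.
  by rewrite ler_pdivlMr ?mulr_gt0//; lra.
clearbody eps al be.
exists eps => // T xi cxi xi0 hit t /andP[t0 tT'].
pose y := 2 * Num.sqrt (t + r ^+ 2).
have tr0 : 0 < t + r ^+ 2 by rewrite ltr_wpDl.
have y0 : 0 < y by rewrite mulr_gt0// sqrtr_gt0.
have y2 : y ^+ 2 = 4 * (t + r ^+ 2).
  by rewrite /y exprMn sqr_sqrtr ?ltW//; ring.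
clearbody y.
have yY : y <= Y.
  rewrite -ler_sqr ?nnegrE ?(ltW y0) ?(ltW Y0)// y2.
  have : 0 <= (Tm - 1) ^+ 2 by exact: sqr_ge0.
  by rewrite /Y; nra.
(* S is a time until which both y and - y survive: y ^ 2 / 4 - eps *)
pose S := t + r ^+ 2 - eps.
have solution x : x ^+ 2 = y ^+ 2 -> x != 0 ->
    S <= T /\ exists2 u, u 0 = x & real_solution S xi u.
  move=> x2 x0; have [|tau tauE] := hit x; first by rewrite x2 y2; lra.
  rewrite x2 y2 ler_norml => /andP[taug _].
  have St : S <= tau by rewrite /S; lra.
  have [|tauT [u u0 su]] := hitting_time_solution tauE; first by rewrite xi0.
  split; first exact: le_trans tauT.
  exists u => //; apply: loewner_ode_subset su => s /=; rewrite !in_itv/=.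
  by move=> /andP[-> /lt_le_trans]; apply.
have [ST [u u0 su]] := solution y erefl (lt0r_neq0 y0).
have [|_ [v v0 sv]] := solution (- y) (sqrrN y).
  by rewrite oppr_eq0 gt_eqF.
have suv : straddling S xi u v.
  split=> //; last by rewrite u0 v0 xi0 oppr_lt0 y0.
  apply: continuous_subspaceW cxi => s /=; rewrite !in_itv/= => /andP[-> sS].
  exact: le_trans (ltW sS) ST.
have tS : 0 <= t < S by rewrite t0 /S; lra.
split; first by case/andP: tS => _ /ltW /le_trans; apply.
have : `|xi t| <= al * (4 * y ^+ 2 - 16 * S) + 2 * be * y + 2 * r.
  apply: (straddling_driver_bound (c := 2 * r) suv u0 v0 tS al0 (ltW be0)).
  - by rewrite mulr_ge0// ltW.
  - by lra.
  - by rewrite exprMn /S; lra.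
  - by rewrite mulr_ge0// ltW.
  - by rewrite exprMn y2; lra.
move=> /le_trans; apply.
have -> : 4 * y ^+ 2 - 16 * S = 16 * eps by rewrite y2 /S; ring.
have := ler_wpM2l (ltW be0) yY.
lra.
Qed.

Lemma loewner_ode_opp (R : realType) (I : set R) (xi u : R -> R) :
  loewner_ode (id : R -> R) I xi u ->
  loewner_ode (id : R -> R) I (fun s => - xi s) (fun s => - u s).
Proof.
move=> ode t It; have [uxi du] := ode t It; split.
  by rewrite -subr_eq0 opprK addrC subr_eq0 eq_sym.
have -> : - 2 / (- u t - id (- xi t)) = - (- 2 / (u t - id (xi t))).
  by rewrite /= -opprD invrN mulrN.
have -> : (fun s => (- u s - - u t) / id (s - t))
    = (fun s => - ((u s - u t) / id (s - t))).
  by apply/funext => s; rewrite -opprD mulNr.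
exact: cvgN.
Qed.

(** The explicit solution is sg x * sqrt (x ^ 2 - 4 s), which shows that the
    point x is hit at time x ^ 2 / 4. For the converse, u ^ 2 + 4 s does not
    decrease along any solution u, so u stays away from 0 before that time. *)
Lemma zero_driver_hitting_time (R : realType) (T x : R) :
  x ^+ 2 / 4 <= T -> hitting_time T (fun=> 0) x = (x ^+ 2 / 4)%:E.
Proof.
move=> xT; rewrite /hitting_time.
case: eqVneq => [->|x0]; first by rewrite expr0n/= mul0r.
have x20 : 0 < x ^+ 2 by rewrite exprn_even_gt0.
have t0 : 0 < x ^+ 2 / 4 by rewrite divr_gt0.
apply/eqP; rewrite eq_le; apply/andP; split.
- pose u s := Num.sg x * Num.sqrt (x ^+ 2 - 4 * s).
  have cs : continuous (fun s : R => Num.sqrt (x ^+ 2 - 4 * s)).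
    move=> s; apply: continuous_comp; last exact: sqrt_continuous.
    apply: cvgB; first exact: cvg_cst.
    by apply: cvgM; [exact: cvg_cst|exact: cvg_id].
  have cu : continuous u.
    by move=> s; apply: cvgM; [exact: cvg_cst|exact: cs].
  have sg2 : Num.sg x ^+ 2 = 1 by rewrite sqr_sg x0.
  have u2 s : s <= x ^+ 2 / 4 -> u s ^+ 2 = x ^+ 2 - 4 * s.
    by move=> sx; rewrite exprMn sg2 mul1r sqr_sqrtr//; lra.
  have u_neq0 s : s < x ^+ 2 / 4 -> u s != 0.
    by move=> sx; rewrite -sqrf_eq0 u2 ?(ltW sx)// gt_eqF//; lra.
  apply: ereal_inf_lbound; exists (x ^+ 2 / 4) => //=.
  split; first by rewrite t0.
  exists u; split.
  + by rewrite /u mulr0 subr0 sqrtr_sqr -numEsg.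
  + move=> t /=; rewrite in_itv/= => /andP[_ tx].
    rewrite subr0 u_neq0//; split => //.
    have cc : - 4 / (u s + u t) @[s --> within `[0, x ^+ 2 / 4[ t^']
        --> - 2 / u t.
      have ut0 : u t + u t != 0 by rewrite -mulr2n mulrn_eq0 u_neq0.
      rewrite (_ : - 2 / u t = - 4 / (u t + u t)); last first.
        by field; rewrite ut0 u_neq0.
      apply: cvgM; first exact: cvg_cst.
      apply: cvgV => //.
      apply: cvgD; last exact: cvg_cst.
      by apply: cvg_within_filter; apply: cvg_within_filter; exact: cu.
    apply: cvg_trans cc; apply: near_eq_cvg.
    suff : \forall s \near t, s != t -> `[0, x ^+ 2 / 4[%classic s ->
      - 4 / (u s + u t) = (u s - u t) / (s - t) by [].
    apply: (@filterE _ (nbhs t)) => s st /=; rewrite in_itv/= => /andP[_ sx].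
    have E : (u s - u t) * (u s + u t) = - 4 * (s - t).
      by rewrite -subr_sqr !u2 ?ltW//; ring.
    have stN0 : s - t != 0 by rewrite subr_eq0.
    have uN0 : u s + u t != 0.
      apply/eqP => us; move/eqP: E; rewrite us mulr0 eq_sym mulf_eq0.
      by rewrite (negPf stN0) oppr_eq0 pnatr_eq0.
    by apply/eqP; rewrite eqr_div// E.
  + apply: limf_einf_at_left_eq0 => //.
    have : `|u s - 0| @[s --> (x ^+ 2 / 4)^'-] --> `|u (x ^+ 2 / 4) - 0|.
      apply: cvg_norm; apply: cvgB; last exact: cvg_cst.
      by apply: cvg_within_filter; exact: cu.
    by rewrite subr0 {2}/u (_ : x ^+ 2 - _ = 0) ?sqrtr0 ?mulr0 ?normr0//; field.
- apply: le_ereal_inf_tmp => _ [t [/andP[t1 tT] [u [u0 su lim0]]] <-].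
  rewrite lee_fin leNgt; apply/negP => tx.
  have u2 s : 0 <= s < t -> x ^+ 2 - 4 * s <= u s ^+ 2.
    move=> /andP[s0 st].
    have sNu : real_solution t (fun=> 0) (fun s => - u s).
      by have := loewner_ode_opp su; rewrite oppr0.
    have s00 : 0 <= (0 : R) <= s by rewrite lexx.
    (* u and - u solve the same equation, with gap 2 u *)
    have := potential_nincr (al := -1) (be := 0) (ka := 0) (ga := -16) su sNu
      s00 st.
    rewrite /potential => h.
    suff : -1 * (u s - - u s) ^+ 2 + 0 * (u s - - u s) + 0 * ((u s - u s) / 2)
        + -16 * s <= -1 * (u 0 - - u 0) ^+ 2 + 0 * (u 0 - - u 0)
        + 0 * ((u 0 - u 0) / 2) + -16 * 0 by rewrite u0; lra.
    apply: h => r /andP[r0 rs] /=.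
    have [|ur0 _] := su r; first by rewrite /= in_itv/= ltW//= (lt_trans rs).
    rewrite subr0 sub0r opprK [X in X <= 0](_ : _ = 0)//.
    by field; rewrite ur0.
  have : ((Num.sqrt (x ^+ 2 - 4 * t))%:E <=
      limf_einf (fun s => `|u s - 0|%:E) t^'-)%E.
    apply: limf_einf_at_left_ge => // s /[dup] st /andP[s0 st'].
    rewrite subr0 -sqrtr_sqr ler_wsqrtr//; apply: le_trans (u2 s st).
    lra.
  by rewrite lim0 lee_fin leNgt sqrtr_gt0; lra.
Qed.

Lemma uniform_cvg_distP (R : realType) (K : set R) (f_ : nat -> R -> R)
    (f : R -> R) :
  {uniform K, f_ @ \oo --> f} <->
  forall e, 0 < e -> \forall n \near \oo, forall x, K x -> `|f x - f_ n x| < e.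
Proof.
split=> [cf e e0|cf P].
  apply: (cf [set h | forall x, K x -> `|f x - h x| < e]).
  apply/uniform_nbhs; exists [set xy : R * R | `|xy.1 - xy.2| < e]; split=> //.
  by rewrite -entourage_from_ballE; exists e.
move=> /uniform_nbhs[E [entE EP]].
move: entE; rewrite -entourage_from_ballE => -[e /= e0 eE].
by apply: filterS (cf e e0) => n ne; apply: EP => x Kx; apply: eE; exact: ne.
Qed.

(** * Recovery of the driver *)

(** If xi 0 were outside [- y0, y0], then the endpoint on its side would be
    hit no later than the farther point 0, which is impossible because the
    hitting times are y0 ^ 2 / 4 and 0 respectively. Inside the interval, xi 0
    is hit at time 0, which is also xi 0 ^ 2 / 4. *)
Lemma quadratic_hitting_times_init (R : realType) (T y0 : R) (xi : R -> R) :
  0 < y0 -> driver T xi ->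
  (forall x, - y0 <= x <= y0 -> hitting_time T xi x = (x ^+ 2 / 4)%:E) ->
  xi 0 = 0.
Proof.
move=> y00 cxi hit.
have side (y : R) : y ^+ 2 = y0 ^+ 2 -> - y0 <= y <= y0 -> y * (xi 0 - y) <= 0.
  move=> y2 yy; rewrite leNgt; apply/negP => h.
  have := @hitting_time_le _ _ _ 0 _ _ cxi (hit y yy); rewrite subr0 => /(_ h).
  rewrite hit; last by rewrite oppr_le0 ltW//= ltW.
  by rewrite lee_fin y2 expr0n/= mul0r leNgt divr_gt0// exprn_gt0.
have xi_in : - y0 <= xi 0 <= y0.
  have h1 : y0 * (xi 0 - y0) <= 0 by apply: side; [by []|lra].
  have h2 : - y0 * (xi 0 - - y0) <= 0 by apply: side; [exact: sqrrN|lra].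
  by apply/andP; split; nra.
have := hit _ xi_in; rewrite /hitting_time eqxx => -[] /eqP.
by rewrite eq_sym mulf_eq0 invr_eq0 pnatr_eq0 orbF sqrf_eq0 => /eqP.
Qed.

(** Before time y0 ^ 2 / 4 the hitting times are eps-close to those of the zero
    driver for every eps; the final time follows by continuity. *)
Lemma quadratic_hitting_times_driver (R : realType) (T y0 : R) (xi : R -> R) :
  0 < y0 -> driver T xi ->
  (forall x, - y0 <= x <= y0 -> hitting_time T xi x = (x ^+ 2 / 4)%:E) ->
  forall t, 0 <= t <= y0 ^+ 2 / 4 -> xi t = 0.
Proof.
move=> y00 cxi hit.
have xi0 := quadratic_hitting_times_init y00 cxi hit.
have before t : 0 <= t < y0 ^+ 2 / 4 -> xi t = 0.
  move=> /andP[t0 ty]; apply/eqP; rewrite -normr_le0.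
  apply/ler_addgt0Pr => e e0.
  rewrite add0r; have [eps eps0] := near_zero_hitting_times t0 ty e0.
  move=> /(_ T xi cxi xi0) near0; suff [] : t <= T /\ `|xi t| <= e by [].
  apply: near0; last by rewrite t0 lexx.
  move=> x x2; exists (x ^+ 2 / 4); last by rewrite subrr normr0 ltW.
  apply: hit; rewrite -ler_norml -ler_sqr ?nnegrE ?(ltW y00)//.
  by rewrite real_normK ?num_real//; lra.
move=> t /andP[t0]; rewrite le_eqVlt => /predU1P[->|ty]; last first.
  by apply: before; rewrite t0.
set t1 := y0 ^+ 2 / 4.
have t10 : 0 < t1 by rewrite divr_gt0// exprn_gt0.
have hit1 : hitting_time T xi y0 = t1%:E by apply: hit; lra.
have [|t1T _] := hitting_time_solution hit1; first by rewrite xi0 gt_eqF.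
have : {within `[0, t1], continuous xi}.
  apply: continuous_subspaceW cxi => s /=.
  by rewrite !in_itv/= => /andP[-> /le_trans]; apply.
move=> /(continuous_within_itvP _ t10)[_ _ cxi1].
apply: (@cvg_unique _ (@Rhausdorff R) _ _ _ _ cxi1).
apply: cvg_trans (@cvg_cst _ 0 _ t1^'- _); apply: near_eq_cvg.
have : \forall s \near t1^'-, 0 < s by exact: nbhs_left_gt.
apply: filterS2 (nbhs_left_lt t1) => s st s0.
by rewrite before// ltW.
Qed.

(** The estimate for near-quadratic hitting times needs them on [- y, y] with
    y ^ 2 / 4 strictly between T' and a ^ 2 / 4: a compact subset of ]a, - a[,
    contained in [a_n, b_n] for large n. *)
Lemma near_quadratic_hitting_times_cvg (R : realType) (a : R)
    (T_ a_ b_ : nat -> R) (xi_ tau_ : nat -> R -> R) :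
  a < 0 ->
  (forall n, driver (T_ n) (xi_ n)) -> (forall n, xi_ n 0 = 0) ->
  (forall n x, a_ n <= x <= b_ n ->
     hitting_time (T_ n) (xi_ n) x = (tau_ n x)%:E) ->
  a_ n @[n --> \oo] --> a -> b_ n @[n --> \oo] --> - a ->
  (forall K : set R, compact K -> K `<=` `]a, - a[ ->
     {uniform K, tau_ @ \oo --> (fun x : R => x ^+ 2 / 4)}) ->
  forall T' eta, 0 <= T' < a ^+ 2 / 4 -> 0 < eta ->
  \forall n \near \oo, forall t, 0 <= t <= T' ->
    t <= T_ n /\ `|xi_ n t| <= eta.
Proof.
move=> a0 cxi xi0 hit cva cvb cvtau T' eta /andP[T'0 T'a] eta0.
pose Tm := (T' + a ^+ 2 / 4) / 2.
have [T'm Tma] : T' < Tm /\ Tm < a ^+ 2 / 4 by rewrite /Tm; split; lra.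
have [eps eps0 small] := near_zero_hitting_times T'0 T'm eta0.
pose y := 2 * Num.sqrt Tm.
have y0 : 0 <= y by rewrite mulr_ge0.
have y2 : y ^+ 2 = 4 * Tm.
  by rewrite exprMn sqr_sqrtr ?(le_trans T'0 (ltW T'm))//; ring.
have ya : y < - a.
  by rewrite -ltr_sqr ?nnegrE ?oppr_ge0 ?(ltW a0)// y2 sqrrN; lra.
have yK : `[- y, y] `<=` `]a, - a[.
  by move=> x /=; rewrite !in_itv/= => /andP[? ?]; apply/andP; split; lra.
have /uniform_cvg_distP/(_ eps eps0) := cvtau _ (@segment_compact _ _ _) yK.
have : \forall n \near \oo, a_ n < - y by apply: (cvgr_lt _ cva); lra.
have : \forall n \near \oo, y < b_ n by apply: (cvgr_gt _ cvb).
apply: filterS3 => n yb ya' tau_eps.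
apply: (small _ _ (cxi n) (xi0 n)) => x x2.
have /andP[x1 x1'] : - y <= x <= y.
  by rewrite -ler_norml -ler_sqr ?nnegrE// real_normK ?num_real// y2.
exists (tau_ n x).
  by apply: hit; rewrite (le_trans (ltW ya'))//= (le_trans x1')// ltW.
by rewrite distrC ltW// tau_eps//= in_itv/= x1.
Qed.

Theorem theorem3p12 (R : realType) :
  (forall T x : R, 0 <= T -> x ^+ 2 / 4 <= T ->
     hitting_time T (fun=> 0) x = (x ^+ 2 / 4)%:E) /\
  (forall (T y0 : R) (xi : R -> R),
     0 <= T -> 0 < y0 -> driver T xi ->
     (forall x : R, - y0 <= x <= y0 -> hitting_time T xi x = (x ^+ 2 / 4)%:E) ->
     forall t : R, 0 <= t <= y0 ^+ 2 / 4 -> xi t = 0) /\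
  (forall (a : R) (T_ a_ b_ : nat -> R) (xi_ tau_ : nat -> R -> R),
     a < 0 ->
     (forall n, 0 <= T_ n) ->
     (forall n, simple_curve_driver0 (T_ n) (xi_ n)) ->
     (forall n, maximal_finite_interval
                  (hitting_time (T_ n) (xi_ n)) (a_ n) (b_ n)) ->
     (forall (n : nat) (x : R), a_ n <= x <= b_ n ->
        hitting_time (T_ n) (xi_ n) x = (tau_ n x)%:E) ->
     (forall n, tau_ n (a_ n) = T_ n /\ tau_ n (b_ n) = T_ n) ->
     a_ n @[n --> \oo] --> a ->
     b_ n @[n --> \oo] --> - a ->
     (forall K : set R, compact K -> K `<=` `]a, - a[ ->
        {uniform K, tau_ @ \oo --> (fun x : R => x ^+ 2 / 4)}) ->
     forall T' : R, 0 <= T' < a ^+ 2 / 4 ->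
       (\forall n \near \oo, T' <= T_ n) /\
       {uniform `[0, T'], xi_ @ \oo --> (fun _ : R => 0)}).
Proof.
split; first by move=> T x _; exact: zero_driver_hitting_time.
split; first by move=> T y0 xi _; exact: quadratic_hitting_times_driver.
move=> a T_ a_ b_ xi_ tau_ a0 _ curve _ hit _ cva cvb cvtau T' T'a.
have [cxi xi0] : (forall n, driver (T_ n) (xi_ n)) /\ (forall n, xi_ n 0 = 0).
  by split=> n; have [[? _] ?] := curve n.
have small := near_quadratic_hitting_times_cvg a0 cxi xi0 hit cva cvb cvtau T'a.
have /andP[T'0 _] := T'a.
split.
  apply: filterS (small 1 ltr01) => n /(_ T'); rewrite T'0 lexx.
  by move=> /(_ isT)[].
apply/uniform_cvg_distP => e e0.
apply: filterS (small (e / 2) (divr_gt0 e0 (ltr0n R 2))) => n small_n t /=.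
rewrite in_itv/= => /small_n[_]; rewrite sub0r normrN => /le_lt_trans; apply.
lra.
Qed.
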